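(* Let $G$ be a chordal graph and let $H \subset G$ be a subgraph of $G$ with $V(H) = V(G)$ that is also chordal. Then $H$ can be obtained from $G$ via a sequence of removals of exposed edges; that is, there is a (possibly empty) sequence of edges $(e_1, \dots, e_k)$ with $E(G) \setminus E(H) = \{e_1, \dots, e_k\}$, the $e_i$ pairwise distinct, such that for each $i = 1, \dots, k$ the edge $e_i$ is an exposed edge of the graph $G - \{e_s : s < i\}$.
   Context: Graphs are finite, undirected and simple (no loops or multiple edges), with vertex set $V(G)$ and edge set $E(G)$. A subgraph $H \subset G$ is a graph with $V(H) \subset V(G)$ and $E(H) \subset E(G)$. For a set $S$ of edges, $G - S$ denotes the graph obtained by deleting the edges in $S$ and keeping all vertices. A graph is chordal if it has no induced cycles of length four or more. A clique in $G$ is an induced subgraph that is a complete graph. An edge $e \in E(G)$ is exposed if it is contained in exactly one (inclusion-)maximal clique of $G$ (this clique may be the edge itself). *)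

(* Defs.v *)
From mathcomp Require Import all_boot.

Set Implicit Arguments.
Unset Strict Implicit.
Unset Printing Implicit Defensive.

(* The vertices are drawn from an ambient finite type T, and an edge is the
   2-element set of its ends.  The well-formedness condition is a boolean, so
   that two graphs with the same vertices and edges are equal. *)
Record sgraph (T : finType) := SGraph {
  vertices : {set T};
  edges : {set {set T}};
  sgraph_axiom : [forall e in edges, (e \subset vertices) && (#|e| == 2)]
}.

Section Graphs.
Variable T : finType.
Implicit Types (G H C : sgraph T) (A K e : {set T}) (S : {set {set T}}).

Definition subgraph H G : bool :=
  (vertices H \subset vertices G) && (edges H \subset edges G).

Lemma del_edges_axiom G S :
  [forall e in edges G :\: S, (e \subset vertices G) && (#|e| == 2)].
Proof.
apply/forall_inP => e /setDP[eG _].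
exact: (forall_inP (sgraph_axiom G)) e eG.
Qed.

Definition del_edges G S : sgraph T := SGraph (del_edges_axiom G S).

Lemma induced_axiom G A :
  [forall e in [set e in edges G | e \subset A],
     (e \subset vertices G :&: A) && (#|e| == 2)].
Proof.
apply/forall_inP => e; rewrite inE => /andP[eG eA].
by have /andP[eV ->] := forall_inP (sgraph_axiom G) e eG; rewrite subsetI eV eA.
Qed.

Definition induced G A : sgraph T := SGraph (induced_axiom G A).

Definition complete G : bool :=
  [forall x in vertices G, forall y in vertices G,
     (x != y) ==> ([set x; y] \in edges G)].

(* C is the cycle graph that visits the vertices in s in order; [next] wraps
   around from the last item of s to the first one. *)
Definition cycle_graph C (s : seq T) : Prop :=
  [/\ uniq s, 2 < size s, vertices C = [set x in s]
    & edges C = [set [set x; next s x] | x in s]].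

Definition chordal G : Prop :=
  forall A (s : seq T), A \subset vertices G ->
    cycle_graph (induced G A) s -> size s < 4.

(* A clique, being an induced subgraph, is given by its vertex set. *)
Definition clique G K : bool :=
  (K \subset vertices G) && complete (induced G K).

Definition exposed G e : bool :=
  (e \in edges G) &&
  (#|[set K : {set T} | maxset (clique G) K & e \in edges (induced G K)]| == 1).

End Graphs.

(* Main.v *)
(** An edge xy is exposed iff the common neighbours of x and y form a clique.
    A graph without holes has a simplicial vertex in each nonempty induced
    subgraph (Dirac), and then even one outside any given proper clique.  This
    hereditary property survives the removal of an exposed edge, so it suffices
    to find one exposed edge of G outside H.  Let v be simplicial in H.  If v
    has the same neighbours in G and in H, no edge of G - H lies in the
    neighbourhood of v and one can delete v.  Otherwise N_H(v) is a clique of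
    G[N_G(v)] that misses some vertex, so some w in N_G(v) - N_H(v) is simplicial
    in G[N_G(v)], which says that vw is exposed. *)
Require Import Defs.
From mathcomp Require Import all_boot.

Set Implicit Arguments.
Unset Strict Implicit.
Unset Printing Implicit Defensive.

(** * Cliques and simplicial vertices *)

Section Relations.
Variable T : finType.
Implicit Types (e g h : rel T) (A U W C : {set T}).

Definition is_clique e A :=
  [forall x in A, forall y in A, (x != y) ==> e x y].

Definition neighbors e U w := [set z in U | e w z].

Definition simplicial e U w := is_clique e (neighbors e U w).

(** For the adjacency of a graph this amounts to chordality of the part induced on [U], in a form
    that passes at once to subsets. *)
Definition hereditarily_simplicial e U := forall W,
  W \subset U -> W != set0 -> exists2 w, w \in W & simplicial e W w.

(** The single equation says both that successive vertices are adjacent and that the cycle has no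
    chord. *)
Definition hole e (s : seq T) :=
  [/\ uniq s, 3 < size s
    & {in s &, forall x y, e x y = (y == next s x) || (x == next s y)}].

Lemma is_cliqueP e A :
  reflect {in A &, forall x y, x != y -> e x y} (is_clique e A).
Proof.
apply: (iffP forall_inP) => [cl x y xA yA | cl x xA].
  by move/forall_inP: (cl x xA) => /(_ y yA) /implyP.
by apply/forall_inP => y yA; apply/implyP; apply: cl.
Qed.

Lemma is_cliqueS e A U : A \subset U -> is_clique e U -> is_clique e A.
Proof.
move=> /subsetP AU /is_cliqueP cl; apply/is_cliqueP => x y xA yA.
by apply: cl; apply: AU.
Qed.

Lemma hereditarily_simplicialS e U W :
  W \subset U -> hereditarily_simplicial e U -> hereditarily_simplicial e W.
Proof. by move=> WU hU X XW; apply: hU; apply: subset_trans WU. Qed.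

(** Induction on the size of [U]. If the simplicial vertex [v] of [U] lies in [A], then [A] lies in
    the closed neighbourhood of [v], and it suffices to find [w] outside the latter. *)
Lemma simplicial_outside_clique e U A :
    symmetric e -> hereditarily_simplicial e U ->
    A \proper U -> is_clique e A ->
  exists w, [/\ w \in U, w \notin A & simplicial e U w].
Proof.
move=> e_sym.
have [n] := ubnP #|U|; elim: n => // n IHn in U A *; rewrite ltnS => leUn hU.
move=> /properP[AU [b bU bA]] clA.
have U0 : U != set0 by apply/set0Pn; exists b.
have [v vU sv] := hU U (subxx U) U0.
have [vA | vA] := boolP (v \in A); last by exists v.
set N := neighbors e (U :\ v) v.
have N_U : N \subset neighbors e U v.
  by apply/subsetP => z; rewrite !inE => /andP[/andP[_ ->] ->].
have A_N z : z \in A -> z != v -> z \in N.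
  move=> zA zv; rewrite !inE zv (subsetP AU) //=.
  by apply: (is_cliqueP _ _ clA); rewrite // eq_sym.
have NsubUv : N \subset U :\ v by apply/subsetP => z; rewrite inE => /andP[].
have [NUv | NUv] := boolP (N \proper U :\ v); last first.
  (* Here [v] is adjacent to all the rest, so [U] is a clique and each of its vertices is
     simplicial. *)
  have UvN : U :\ v \subset N.
    by move: NUv; rewrite properE NsubUv negbK.
  exists b; split=> //; apply/is_cliqueP => x y.
  rewrite !inE => /andP[xU _] /andP[yU _].
  have evz z : z \in U -> z != v -> e v z.
    move=> zU zv; have : z \in N by apply: (subsetP UvN); rewrite !inE zv.
    by rewrite inE => /andP[].
  have [-> | xv] := eqVneq x v.
    by move=> vy; apply: evz; rewrite // eq_sym.
  have [-> | yv] := eqVneq y v; first by move=> _; rewrite e_sym; apply: evz.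
  by move=> xy; apply: (is_cliqueP _ _ sv); rewrite // inE ?xU ?yU evz.
(* [N] replaces [A]: a vertex of [U :\ v] outside [N] is not adjacent to [v], so putting [v] back
   leaves its neighbourhood unchanged. *)
have [] := IHn _ N _ _ NUv (is_cliqueS N_U sv).
- by apply: leq_trans leUn; rewrite [X in _ < X](cardsD1 v) vU.
- by apply: hereditarily_simplicialS hU; apply: subD1set.
move=> w []; rewrite in_setD1 => /andP[wv wU] wN sw.
have evw : ~~ e v w by apply: contra wN => evw; rewrite !inE wv wU evw.
exists w; split=> //; first by apply: contra wN => /A_N; apply.
apply: is_cliqueS sw; apply/subsetP => z; rewrite !inE => /andP[zU ewz].
rewrite zU ewz !andbT; apply: contraNneq evw => <-.
by rewrite e_sym.
Qed.

(** * Induced paths, holes and Dirac's theorem *)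

(** Take a walk of minimal length and remove its repetitions: a forward chord would give a shorter
    walk. *)
Lemma connect_induced_path (r : rel T) x y : connect r x y ->
  exists p, [/\ path r x p, last x p = y, uniq (x :: p)
    & forall d i j, i.+1 < j -> j < size (x :: p) ->
        ~~ r (nth d (x :: p) i) (nth d (x :: p) j)].
Proof.
move=> /connectP[p0 rp0 lp0].
pose P n := [exists p : n.-tuple T, path r x p && (last x p == y)].
have exP : exists n, P n.
  exists (size p0); apply/existsP; exists (in_tuple p0).
  by rewrite /= rp0 lp0 eqxx.
case: (ex_minnP exP) => n /existsP[p1 /andP[rp1 /eqP lp1]] minn.
have minp q : path r x q -> last x q = y -> n <= size q.
  move=> rq lq; apply: minn; apply/existsP; exists (in_tuple q).
  by rewrite /= rq lq eqxx.
have sz1 : size p1 = n by rewrite size_tuple.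
move: (tval p1) sz1 rp1 lp1 => p sz rp lp {p1}.
move: lp; case: (shortenP rp) => q rq uq qp lq.
have szq : size q <= n.
  by rewrite -sz; apply: uniq_leq_size => //; case/andP: uq.
exists q; split=> // d i [//|j]; rewrite ltnS => ij; rewrite /= ltnS => jq.
have iq : i < size q by apply: ltn_trans jq.
rewrite (set_nth_default x) 1?ltnW // [nth d q j](set_nth_default x) //.
apply/negP => rij.
have lasti : last x (take i q) = nth x (x :: q) i.
  case: i ij iq {rij} => [|i] ij iq; first by rewrite take0.
  by rewrite (last_nth x) size_takel 1?ltnW //= nth_take.
(* The chord bypasses the vertices between its ends; [j] has been shifted by one, so the far end is
   the head of [drop j q]. *)
have := minp (take i q ++ drop j q).
rewrite cat_path last_cat lasti.
have rpj : path r x (take i q) by apply: take_path.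
rewrite (drop_nth x) //= rpj rij /=.
have rpd : path r (nth x q j) (drop j.+1 q).
  by move: rq; rewrite -{1}(cat_take_drop j q) cat_path (drop_nth x) //=
    => /and3P[].
have lastd : last (nth x q j) (drop j.+1 q) = y.
  by move: lq; rewrite -{1}(cat_take_drop j q) last_cat (drop_nth x).
move=> /(_ rpd lastd). rewrite size_cat (size_takel (ltnW iq)) /= size_drop.
rewrite subnSK // => lenn; have := leq_trans szq lenn.
by rewrite leqNgt -{2}(subnKC (ltnW jq)) ltn_add2r ij.
Qed.

(** Among the vertices of a chordless path, [u] is joined to the two ends only, so it closes the
    path to a chordless cycle; a nonempty [p] makes it long enough. *)
Lemma hole_of_induced_path e u x p y :
    symmetric e -> irreflexive e ->
    path e x (rcons p y) -> uniq (u :: x :: rcons p y) -> 0 < size p ->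
    e u x -> e u y -> {in p, forall z, ~~ e u z} ->
    (forall i j, i.+1 < j -> j < size (x :: rcons p y) ->
        ~~ e (nth u (x :: rcons p y) i) (nth u (x :: rcons p y) j)) ->
  hole e (u :: x :: rcons p y).
Proof.
move=> e_sym e_irr ep uup szp eux euy eup chordless.
set c := u :: x :: rcons p y; split=> //.
  by rewrite /= size_rcons !ltnS.
have cyc : cycle e c by rewrite /= eux rcons_path ep last_rcons e_sym.
(* The default [u] supplies the wrap-around: for the last [i], [nth] runs off the end and returns
   the head of [c]. *)
have nextE i : i < size c -> next c (nth u c i) = nth u (x :: rcons p y) i.
  by move=> ic; rewrite next_nth mem_nth // index_uniq.
have chord i j : i < j -> j < size c -> e (nth u c i) (nth u c j) ->
    (nth u c j == next c (nth u c i)) || (nth u c i == next c (nth u c j)).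
  move=> ij jc; rewrite !nextE //; last exact: ltn_trans jc.
  case: j => // j in ij jc *; case: i => [|i] in ij *; last first.
    move=> eij; have [<- | nij] := eqVneq i.+1 j; first by rewrite eqxx.
    by rewrite /= (negPf (chordless i j _ jc)) // ltn_neqAle nij in eij.
  case: j => [|j] in ij jc *; first by rewrite eqxx.
  (* One end is now [u], which has no neighbour in [p]; only [y] remains, and its successor is
     [u]. *)
  have [jp | jp] := ltnP j (size p).
    by rewrite /= nth_rcons jp (negPf (eup _ (mem_nth u jp))).
  by rewrite orbC [nth u (x :: _) _]nth_default ?eqxx //= size_rcons ltnS.
move=> a b ac bc; apply/idP/idP; last first.
  by case/orP => /eqP->; [| rewrite e_sym]; apply: next_cycle.
rewrite -(nth_index u ac) -(nth_index u bc).
have := ac; have := bc; rewrite -!index_mem.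
move: (index a c) (index b c) => i j jc ic.
case: (ltngtP i j) => [ij | ji | ->].
- exact: chord.
- by rewrite e_sym orbC; apply: chord.
- by rewrite e_irr.
Qed.

(* Dirac: the neighbourhood S of a component C of the non-neighbours of u is a
   clique, so that a simplicial vertex of C :|: S outside S is simplicial. *)
Lemma hole_free_hereditarily_simplicial e U :
    symmetric e -> irreflexive e -> (forall s, ~ hole e s) ->
  hereditarily_simplicial e U.
Proof.
move=> e_sym e_irr no_hole W _.
have [n] := ubnP #|W|; elim: n => // n IHn in W *; rewrite ltnS => leWn W0.
have [clW | nclW] := boolP (is_clique e W).
  have [w wW] := set0Pn _ W0; exists w => //.
  by apply: is_cliqueS clW; apply/subsetP => z; rewrite inE => /andP[].
have [u [c [uW cW uc euc]]] :
    exists u c, [/\ u \in W, c \in W, u != c & ~~ e u c].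
  move: nclW; rewrite negb_forall_in => /exists_inP[u uW].
  rewrite negb_forall_in => /exists_inP[c cW]; rewrite negb_imply => /andP[].
  by exists u, c.
pose W' := [set z in W | (z != u) && ~~ e u z].
pose r := [rel a b | [&& e a b, a \in W' & b \in W']].
pose C := [set z | connect r c z].
pose S := [set z in W | e u z && [exists a in C, e a z]].
have r_sym : symmetric r.
  by move=> a b; rewrite /= e_sym; congr (_ && _); rewrite andbC.
have CW' z : z \in C -> z \in W'.
  rewrite inE => /connectP[p]; elim/last_ind: p => [_ -> | p y _].
    by rewrite inE cW eq_sym uc.
  by rewrite rcons_path last_rcons => /andP[_ /and3P[_ _ yW']] ->.
have CC a b : a \in C -> b \in W' -> e a b -> b \in C.
  move=> aC bW' eab; move: (aC); rewrite !inE => /connect_trans; apply.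
  by apply: connect1; rewrite /= eab bW' CW'.
(* Nonadjacent [s] and [t] in [S] are joined by an induced path with interior in [W'], hence away
   from the neighbours of [u]; together with [u] it forms a hole. *)
have clS : is_clique e S.
  apply/is_cliqueP => s t; rewrite !inE.
  move=> /and3P[sW eus /exists_inP[a aC eas]].
  move=> /and3P[tW eut /exists_inP[b bC ebt]] st.
  apply/negPn/negP => est.
  pose D := s |: (t |: W').
  pose rD := [rel a b | [&& e a b, a \in D & b \in D]].
  have W'D z : z \in W' -> z \in D by move=> zW; rewrite !in_setU zW !orbT.
  have sD : s \in D by rewrite setU11.
  have tD : t \in D by rewrite setU1r // setU11.
  have rab : connect rD a b.
    have : connect r a b.
      move: aC bC; rewrite !inE (sym_connect_sym r_sym); exact: connect_trans.
    apply: connect_sub => a1 b1 /and3P[eab aW bW].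
    by apply: connect1; rewrite /= eab !W'D.
  have /connect_induced_path[p [rp lp up chp]] : connect rD s t.
    apply: (@connect_trans _ _ a).
      by apply: connect1; rewrite /= e_sym eas sD W'D // CW'.
    by apply: connect_trans rab _; apply: connect1; rewrite /= ebt tD W'D // CW'.
  have pD z : z \in s :: p -> z \in D.
    rewrite inE => /predU1P[-> // | ].
    elim: (p) (s) rp => //= y q IHq x /andP[/and3P[_ _ yD] rq].
    by rewrite inE => /predU1P[-> // | ]; apply: IHq rq.
  have neu z : z \in D -> z != u.
    rewrite !inE => /or3P[/eqP-> | /eqP-> | /and3P[] //].
      by apply: contraTneq eus => ->; rewrite e_irr.
    by apply: contraTneq eut => ->; rewrite e_irr.
  case/lastP: p => [|p y] in rp lp up chp pD *.
    by rewrite /= in lp; rewrite lp eqxx in st.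
  rewrite last_rcons in lp; rewrite {}lp {y} in rp up chp pD.
  apply: (no_hole (u :: s :: rcons p t)); apply: hole_of_induced_path => //.
  - by apply: sub_path rp => x y /and3P[].
  - rewrite cons_uniq up andbT; apply/negP => /pD /neu.
    by rewrite eqxx.
  - by case: (p) rp => //=; rewrite (negPf est).
  - move=> z zp; have : z \in D by apply: pD; rewrite inE mem_rcons inE zp !orbT.
    move: up; rewrite /= mem_rcons inE rcons_uniq.
    move=> /and3P[/norP[_ sp] tp _].
    rewrite !inE => /or3P[/eqP zs | /eqP zt | /and3P[] //].
      by rewrite -zs zp in sp.
    by rewrite -zt zp in tp.
  - move=> i j ij jp; apply: contra (chp u i j ij jp) => eij.
    have ip : i < size (s :: rcons p t) by rewrite (ltn_trans _ jp) // ltnW.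
    by apply/and3P; split; rewrite // pD ?mem_nth.
have cC : c \in C by rewrite inE connect0.
have cS : c \notin S by rewrite inE (negPf euc) andbF.
have CS_W : C :|: S \subset W.
  apply/subsetP => z; rewrite inE => /orP[/CW' | ]; rewrite inE => /andP[] //.
have uCS : u \notin C :|: S.
  rewrite inE negb_or; apply/andP; split.
    by apply/negP => /CW'; rewrite inE eqxx andbF.
  by rewrite inE e_irr andbF.
(* [C :|: S] misses [u], so the induction hypothesis covers all its nonempty subsets. *)
have [] := @simplicial_outside_clique e (C :|: S) S e_sym _ _ clS.
- move=> X XCS; apply: IHn; apply: leq_trans leWn; apply: proper_card.
  apply/properP; split; first exact: subset_trans CS_W.
  by exists u => //; apply: contra uCS; apply: (subsetP XCS).
- by apply/properP; split; [apply: subsetUr | exists c; rewrite // inE cC].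
move=> w [wCS wS sw]; exists w; first exact: (subsetP CS_W).
have wC : w \in C by move: wCS; rewrite inE (negPf wS) orbF.
(* All neighbours of [w] in [W] are accounted for: those adjacent to [u] are in [S], the others in
   [C]. *)
apply: is_cliqueS sw; apply/subsetP => z; rewrite inE => /andP[zW ewz].
have zu : z != u.
  apply: contraTneq ewz => ->; have := CW' _ wC.
  by rewrite inE e_sym => /and3P[].
rewrite inE ewz andbT inE; have [euz | euz] := boolP (e u z).
  by apply/orP; right; rewrite inE zW euz; apply/exists_inP; exists w.
by apply/orP; left; apply: CC ewz; rewrite // inE zW zu.
Qed.

(** * Finding and deleting a removable edge *)

Lemma exists_removable_edge e h U x y :
    symmetric e -> irreflexive e -> symmetric h -> subrel h e ->
    hereditarily_simplicial e U -> hereditarily_simplicial h U ->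
    x \in U -> y \in U -> e x y -> ~~ h x y ->
  exists a b, [/\ a \in U, b \in U, e a b, ~~ h a b
    & is_clique e [set z in U | e a z && e b z]].
Proof.
move=> e_sym e_irr h_sym he.
have [n] := ubnP #|U|; elim: n => // n IHn in U x y *; rewrite ltnS => leUn.
move=> eU hU xU yU exy hxy.
have U0 : U != set0 by apply/set0Pn; exists x.
have [v vU sv] := hU U (subxx U) U0.
have cl : is_clique e (neighbors h U v).
  apply/is_cliqueP => a b aN bN ab; apply: he.
  exact: (is_cliqueP _ _ sv).
have [NN | NN] := boolP (neighbors e U v \subset neighbors h U v).
  have hv z : z \in U -> e v z -> h v z.
    move=> zU evz; have : z \in neighbors h U v.
      by apply: (subsetP NN); rewrite inE zU.
    by rewrite inE => /andP[].
  (* Since [e] and [h] agree at [v], the pair [x], [y] survives the deletion of [v]. *)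
  have xv : x != v by apply: contraNneq hxy => xv; rewrite xv hv // -xv.
  have yv : y != v.
    by apply: contraNneq hxy => yv; rewrite h_sym yv hv // -yv e_sym.
  have [] := IHn (U :\ v) x y _ _ _ _ _ exy hxy.
  - by apply: leq_trans leUn; rewrite [X in _ < X](cardsD1 v) vU.
  - by apply: hereditarily_simplicialS eU; apply: subD1set.
  - by apply: hereditarily_simplicialS hU; apply: subD1set.
  - by rewrite !inE xv.
  - by rewrite !inE yv.
  move=> a [b [aU bU eab hab clab]].
  rewrite !inE in aU bU; case/andP: aU bU => av aU /andP[bv bU].
  exists a, b; split=> //; apply: is_cliqueS clab; apply/subsetP => z.
  rewrite !inE => /and3P[zU eaz ebz]; rewrite zU eaz ebz !andbT.
  (* If [v] were a common neighbour, [a] and [b] would be neighbours of [v] in [h] too, hence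
     adjacent in [h]. *)
  apply: contra hab => /eqP zv; rewrite zv e_sym in eaz.
  rewrite zv e_sym in ebz.
  apply: (is_cliqueP _ _ sv); rewrite ?inE ?aU ?bU ?hv //.
  by apply: contraTneq eab => ->; rewrite e_irr.
have [] := @simplicial_outside_clique e (neighbors e U v) (neighbors h U v)
  e_sym _ _ cl.
- apply: hereditarily_simplicialS eU.
  by apply/subsetP => z; rewrite inE => /andP[].
- by rewrite properE NN andbT; apply/subsetP => z; rewrite !inE => /andP[-> /he].
move=> w []; rewrite inE => /andP[wU evw]; rewrite inE wU /= => hvw sw.
(* The neighbours of [w] inside the [e]-neighbourhood of [v] are the common neighbours of [v] and
   [w]. *)
exists v, w; split=> //; apply: is_cliqueS sw; apply/subsetP => z.
by rewrite !inE andbA.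
Qed.

(** This set is the candidate for the unique maximal clique through the edge. *)
Lemma closed_common_neighbors_clique e x y :
    symmetric e -> e x y -> is_clique e [set z | e x z && e y z] ->
  is_clique e (x |: (y |: [set z | e x z && e y z])).
Proof.
move=> e_sym exy /is_cliqueP cl; apply/is_cliqueP => a b.
rewrite !inE => /or3P[/eqP-> | /eqP-> | /andP[xa ya]];
  move=> /or3P[/eqP-> | /eqP-> | /andP[xb yb]] //.
- by rewrite eqxx.
- by rewrite e_sym.
- by rewrite eqxx.
- by rewrite e_sym.
- by rewrite e_sym.
- by apply: cl; rewrite inE ?xa ?xb.
Qed.

(* Let K consist of x, y and their common neighbours.  A simplicial vertex of W
   outside K is not adjacent to both ends of the deleted edge and so remains
   simplicial; if W lies in K, then x is simplicial after the deletion, and if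
   moreover x is not in W, then W is still a clique. *)
Lemma hereditarily_simplicial_del_edge e g U x y :
    symmetric e -> hereditarily_simplicial e U -> e x y ->
    is_clique e [set z | e x z && e y z] ->
    (forall a b, g a b = e a b && ([set a; b] != [set x; y])) ->
  hereditarily_simplicial g U.
Proof.
move=> e_sym eU exy /(closed_common_neighbors_clique e_sym exy).
set K := x |: _ => clK gE W WU W0.
(* Only the pair [x], [y] is lost, so an [e]-clique without one of them stays a clique. *)
have clg A : is_clique e A -> ~~ ([set x; y] \subset A) -> is_clique g A.
  move=> /is_cliqueP cl nA; apply/is_cliqueP => a b aA bA ab.
  rewrite gE cl //=; apply: contraNneq nA => <-.
  by rewrite subUset !sub1set aA.
have [WK | WK] := boolP (W \subset K).
  have clW := is_cliqueS WK clK.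
  have NW w : neighbors g W w \subset W.
    by apply/subsetP => z; rewrite inE => /andP[].
  have [xW | xW] := boolP (x \in W).
    exists x => //; apply: clg; first exact: is_cliqueS clW.
    by rewrite subUset !sub1set !inE !gE eqxx !andbF.
  have [w wW] := set0Pn _ W0; exists w => //.
  apply: is_cliqueS (NW w) (clg _ clW _).
  by rewrite subUset !sub1set (negPf xW).
have [||| w [wW wK sw]] := @simplicial_outside_clique e W (W :&: K) e_sym.
- exact: hereditarily_simplicialS eU.
- by rewrite properE subsetIl subsetI subxx.
- exact: is_cliqueS (subsetIr _ _) clK.
exists w => //; apply: clg.
  apply: is_cliqueS sw; apply/subsetP => z.
  by rewrite !inE gE => /and3P[-> ->].
apply: contra wK; rewrite subUset !sub1set !inE !gE wW /=.
move=> /andP[/and3P[_ wx _] /and3P[_ wy _]].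
by rewrite ![e _ w]e_sym wx wy !orbT.
Qed.

End Relations.

(** * From graphs to adjacency relations *)

Section ExposedEdges.
Variable T : finType.
Implicit Types (G H : sgraph T) (K e : {set T}) (S : {set {set T}}).

Definition adj G : rel T := fun x y => [set x; y] \in edges G.

Lemma edgeP G e : e \in edges G -> e \subset vertices G /\ #|e| = 2.
Proof. by move=> /(forall_inP (sgraph_axiom G))/andP[-> /eqP]. Qed.

Lemma adj_sym G : symmetric (adj G).
Proof. by move=> x y; rewrite /adj setUC. Qed.

Lemma adj_irr G : irreflexive (adj G).
Proof. by move=> x; apply/negP => /edgeP[_]; rewrite setUid cards1. Qed.

Lemma sgraph_eq G H : vertices G = vertices H -> edges G = edges H -> G = H.
Proof.
case: G H => [V E axG] [V' E' axH] /= eqV eqE; subst V' E'.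
by rewrite (bool_irrelevance axG axH).
Qed.

Lemma del_edges0 G : del_edges G set0 = G.
Proof. by apply: sgraph_eq; rewrite //= setD0. Qed.

Lemma del_edgesU G S1 S2 :
  del_edges (del_edges G S1) S2 = del_edges G (S1 :|: S2).
Proof. by apply: sgraph_eq; rewrite //= setDDl. Qed.

(** The vertices of a hole induce a [cycle_graph] in the same order, so chordality would force fewer
    than four of them. *)
Lemma chordal_hole_free G s : chordal G -> ~ hole (adj G) s.
Proof.
move=> chG [us szs adjE].
have adj_next z : z \in s -> adj G z (next s z).
  by move=> zs; rewrite adjE ?mem_next ?eqxx.
have sV : [set z in s] \subset vertices G.
  apply/subsetP => z; rewrite inE => /adj_next/edgeP[/subsetP zV _].
  by apply: zV; rewrite !inE eqxx.
have : size s < 4; last by rewrite ltnNge szs.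
apply: (chG _ _ sV); split=> //=; first exact: ltnW; first exact: (setIidPr sV).
apply/setP => e; rewrite inE; apply/andP/imsetP => [[eG es] | [x xs ->]].
  have /eqP/cards2P[a [b [_ eE]]] := (edgeP eG).2.
  move: eG es; rewrite eE subUset !sub1set !inE => abG /andP[aS bS].
  have := abG; rewrite -[_ \in _]/(adj G a b) adjE //.
  by case/orP => /eqP->; [exists a | exists b; rewrite // setUC].
by rewrite subUset !sub1set !inE mem_next xs; split=> //; apply: adj_next.
Qed.

Lemma chordal_hereditarily_simplicial G U :
  chordal G -> hereditarily_simplicial (adj G) U.
Proof.
move=> chG; apply: hole_free_hereditarily_simplicial.
- exact: adj_sym.
- exact: adj_irr.
- by move=> s; apply: chordal_hole_free.
Qed.

Lemma cliqueE G K :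
  clique G K = (K \subset vertices G) && is_clique (adj G) K.
Proof.
rewrite /clique; apply: andb_id2l => KV; rewrite /complete /= (setIidPr KV).
apply: eq_forallb_in => x xK; apply: eq_forallb_in => y yK.
by rewrite inE subUset !sub1set xK yK /= andbT.
Qed.

(** The closed common neighbourhood [K] is a clique that contains every clique through [x] and [y],
    so it is the only maximal one. *)
Lemma exposed_edge G x y :
    adj G x y -> is_clique (adj G) [set z | adj G x z && adj G y z] ->
  exposed G [set x; y].
Proof.
move=> xy /(closed_common_neighbors_clique (@adj_sym G) xy).
set K := x |: _ => clK; have xyG : [set x; y] \in edges G := xy.
rewrite /exposed xyG /=; apply/cards1P; exists K.
have clqK : clique G K.
  rewrite cliqueE clK andbT; apply/subsetP => z zK.
  have [zx | zx] := eqVneq z x.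
    by apply: (subsetP (edgeP xy).1); rewrite zx !inE eqxx.
  have zG : adj G z x by apply: (is_cliqueP _ _ clK); rewrite // !inE eqxx.
  by apply: (subsetP (edgeP zG).1); rewrite !inE eqxx.
have sub_K M : clique G M -> [set x; y] \subset M -> M \subset K.
  rewrite cliqueE subUset !sub1set => /andP[_ /is_cliqueP clM] /andP[xM yM].
  apply/subsetP => z zM; rewrite !inE.
  have [//| zx] := eqVneq z x; have [//| zy] := eqVneq z y.
  by rewrite /= !clM // eq_sym.
have xyK : [set x; y] \subset K by rewrite subUset !sub1set !inE !eqxx orbT.
apply/setP => M; rewrite !inE xyG /=.
apply/andP/eqP => [[/maxsetP[cM mM] xyM] | ->].
  by rewrite (mM K clqK) // sub_K.
split=> //; apply/maxsetP; split=> // N cN KN.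
by apply/eqP; rewrite eqEsubset KN sub_K // (subset_trans xyK).
Qed.

End ExposedEdges.

(** * Assembling the removal sequence *)

Theorem proposition1p2 (T : finType) (G H : sgraph T)
    (chordalG : chordal G) (subHG : subgraph H G)
    (spanHG : vertices H = vertices G) (chordalH : chordal H) :
  exists es : seq {set T},
    [/\ uniq es,
        edges G :\: edges H = [set e in es]
      & forall i : nat, i < size es ->
          exposed (del_edges G [set e in take i es]) (nth set0 es i)].
Proof.
(* [setT] can serve as vertex set: elements outside a graph are isolated for [adj], hence
   simplicial. *)
have simpH := @chordal_hereditarily_simplicial T _ setT chordalH.
have /andP[_] := subHG.
move: (@chordal_hereditarily_simplicial T _ setT chordalG).
have [n] := ubnP #|edges G :\: edges H|.
(* The induction carries hereditary simpliciality of [G] and the inclusion of edges, which both pass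
   to [G']. *)
elim: n => // n IHn in G {chordalG subHG spanHG} *; rewrite ltnS => len simpG HG.
have [GH0 | /set0Pn[f]] := eqVneq (edges G :\: edges H) set0.
  by exists [::]; split=> //; rewrite GH0; apply/setP => e; rewrite !inE.
rewrite inE => /andP[fH fG].
have /eqP/cards2P[x [y [_ fE]]] := (edgeP fG).2; rewrite {f}fE in fH fG.
have [|a [b [_ _ ab nab clab]]] := exists_removable_edge (@adj_sym T G)
  (@adj_irr T G) (@adj_sym T H) _ simpG simpH (in_setT x) (in_setT y) fG fH.
  by move=> u v; apply: (subsetP HG).
have {}clab : is_clique (adj G) [set z | adj G a z && adj G b z].
  by apply: is_cliqueS clab; apply/subsetP => z; rewrite !inE.
set e := [set a; b]; set G' := del_edges G [set e].
have GE : edges G :\: edges H = e |: (edges G' :\: edges H).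
  apply/setP => f; rewrite !inE; have [-> | _] //= := eqVneq f e.
  by rewrite /e [_ \in edges H](negPf nab) [_ \in edges G]ab.
have [||| es [ues esE exp]] := IHn G'.
- by apply: leq_trans len; rewrite GE cardsU1 !inE eqxx andbF.
- apply: hereditarily_simplicial_del_edge (@adj_sym T G) simpG ab clab _.
  by move=> u v; rewrite /adj !inE andbC.
- apply/subsetP => f fH'; rewrite !inE (subsetP HG) // andbT.
  by apply: contraNneq nab => fe; rewrite /adj -/e -fe.
exists (e :: es); split=> /=.
- have : e \notin edges G' :\: edges H by rewrite !inE eqxx andbF.
  by rewrite esE inE ues andbT.
- by rewrite GE esE; apply/setP => f; rewrite !inE.
case=> [_ | i ilt] /=.
  have -> : [set f : {set T} in [::]] = set0 by apply/setP => f; rewrite !inE.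
  by rewrite del_edges0; apply: exposed_edge.
(* The first [i.+1] removed edges are [e] and the first [i] entries of [es]. *)
have := exp i ilt; rewrite del_edgesU.
by congr (exposed (del_edges _ _) _); apply/setP => f; rewrite !inE.
Qed.
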